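(* Let $S$ be a $\mathrm{Cu}$-semigroup with $\mathrm{Full}(S)\neq\emptyset$. Then: (1) $\mathrm{Irc}_S$ preserves the order, i.e. if $x,y\in\mathrm{Full}(S)$ and $x\leq y$, then $\mathrm{Irc}_S(x)\leq\mathrm{Irc}_S(y)$. (2) $\mathrm{Irc}_S(n\cdot x)=n\cdot\mathrm{Irc}_S(x)$ for all $x\in\mathrm{Full}(S)$ and $n\in\mathbb{Z}_{>0}$. (3) Let $(x_n)_{n\in\mathbb{Z}_{>0}}$ be an increasing sequence in $\mathrm{Full}(S)$ with $\sup_n x_n=x$ for $x\in S$. If $\mathcal{F}_x(S)\neq\emptyset$ and $\lim_{n\to\infty}\rho(x,x_n)=1$, then $\sup_n\mathrm{Irc}_S(x_n)=\mathrm{Irc}_S(x)$.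
   Context: For elements $x,y$ of a partially ordered set $P$, $x\ll y$ means: for every increasing sequence $(y_n)$ in $P$ with supremum $y$ there is $n_0$ with $x\leq y_{n_0}$. A $\mathrm{Cu}$-semigroup is a positively ordered abelian monoid $S$ (so $0\leq x$ for all $x$ and the order is compatible with addition) such that: (O1) every increasing sequence in $S$ has a supremum; (O2) every $x\in S$ is the supremum of a sequence $x_0\ll x_1\ll x_2\ll\cdots$; (O3) if $x'\ll x$ and $y'\ll y$ then $x'+y'\ll x+y$; (O4) $\sup_n(x_n+y_n)=\sup_n x_n+\sup_n y_n$ for all increasing sequences $(x_n),(y_n)$. For $x\in S$, $\infty\cdot x=\sup_n n\cdot x$. An element $x$ is full if $\infty\cdot x$ is the largest element of $S$; $\mathrm{Full}(S)$ is the set of full elements. A functional on $S$ is a map $\lambda\colon S\to[0,\infty]$ that is additive, order preserving, satisfies $\lambda(0)=0$, and preserves suprema of increasing sequences. $\mathcal{F}(S)$ is the set of functionals on $S$, and $\mathcal{F}_z(S)=\{\lambda\in\mathcal{F}(S):\lambda(z)=1\}$ for $z\in S$. The rank of $x$ is $\widehat{x}\colon\mathcal{F}(S)\to[0,\infty]$, $\widehat{x}(\lambda)=\lambda(x)$; inequalities between ranks are pointwise on $\mathcal{F}(S)$. Rank ratio: $\rho(x,y)=\inf\{r\in(0,\infty):\widehat{x}\leq r\cdot\widehat{y}\}$, with $\rho(x,y)=\infty$ if there is no such $r$. Radius of comparison: for $w\in\mathrm{Full}(S)$ and $r\in(0,\infty)$, $S$ has $r$-comparison relative to $w$ if whenever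 $x,y\in S$ satisfy $\widehat{x}+r\cdot\widehat{w}\leq\widehat{y}$, then $x\leq y$. $\mathrm{rc}(S,w)$ is the infimum of all $r\in(0,\infty)$ such that $S$ has $r$-comparison relative to $w$, and $\mathrm{rc}(S,w)=\infty$ if there is no such $r$. The reciprocal radius of comparison function is $\mathrm{Irc}_S\colon\mathrm{Full}(S)\to[0,\infty]$, $\mathrm{Irc}_S(x)=\frac{1}{\mathrm{rc}(S,x)}$, with the conventions $\frac1\infty=0$ and $\frac10=\infty$. *)

(* Defs.v *)
From HB Require Import structures.
From mathcomp Require Import all_boot all_order all_algebra.
From mathcomp Require Import all_classical all_reals all_analysis.

Set Implicit Arguments.
Unset Strict Implicit.
Unset Printing Implicit Defensive.

Import Order.TTheory GRing.Theory Num.Theory.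

Local Open Scope classical_set_scope.
Local Open Scope ring_scope.

(* "Increasing" sequences are not required to increase strictly, as is
   customary for Cuntz semigroups. *)
Definition way_below d (P : porderType d) (x y : P) : Prop :=
  forall u : nat -> P, nondecreasing_seq u -> supremums (range u) y ->
    exists n0, (x <= u n0)%O.

(* A join of [GRing.Nmodule] and [Order.POrder] would clash with
   [Num.POrderedZmodule], so the monoid laws are postulated over the order and
   the [nmodType] structure is derived below. *)
HB.mixin Record isPOMonoid d S of Order.POrder d S := {
  po_zero : S;
  po_add : S -> S -> S;
  po_addA : associative po_add;
  po_addC : commutative po_add;
  po_add0 : left_id po_zero po_add;
  po_zero_le : forall x : S, (po_zero <= x)%O;
  po_add_le : forall x x' y y' : S,
    (x <= x')%O -> (y <= y')%O -> (po_add x y <= po_add x' y')%O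
}.

#[short(type="poMonoidType")]
HB.structure Definition POMonoid d :=
  { S of Order.POrder d S & isPOMonoid d S }.

HB.instance Definition _ d (S : poMonoidType d) :=
  GRing.isNmodule.Build S (@po_addA d S) (@po_addC d S) (@po_add0 d S).

Record is_Cu_semigroup d (S : poMonoidType d) : Prop := {
  cu_O1 : forall u : nat -> S, nondecreasing_seq u ->
    exists s, supremums (range u) s;
  cu_O2 : forall x : S, exists u : nat -> S,
    (forall n, way_below (u n) (u n.+1)) /\ supremums (range u) x;
  cu_O3 : forall x' x y' y : S,
    way_below x' x -> way_below y' y -> way_below (x' + y') (x + y);
  cu_O4 : forall (u v : nat -> S) (s t : S),
    nondecreasing_seq u -> nondecreasing_seq v ->
    supremums (range u) s -> supremums (range v) t ->
    supremums (range (fun n => u n + v n)) (s + t)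
}.

(* Under (O1), the increasing sequence (n x)_n has a supremum, so in a
   Cu-semigroup the default value 0 of [supremum] is never used. *)
Definition cu_infty d (S : poMonoidType d) (x : S) : S :=
  supremum (0 : S) (range (fun n => x *+ n : S)).

Definition Full d (S : poMonoidType d) : set S :=
  [set x | forall y, (y <= cu_infty x)%O].

Record functional (R : realType) d (S : poMonoidType d) := Functional {
  functional_fun :> S -> \bar R;
  functional_ge0 : forall x, (0 <= functional_fun x)%E;
  functional0 : functional_fun 0 = 0%E;
  functionalD : forall x y,
    functional_fun (x + y) = (functional_fun x + functional_fun y)%E;
  functional_le : forall x y,
    (x <= y)%O -> (functional_fun x <= functional_fun y)%E;
  functional_sup : forall (u : nat -> S) (s : S),
    nondecreasing_seq u -> supremums (range u) s ->
    functional_fun s = ereal_sup (range (fun n => functional_fun (u n)))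
}.

Definition functionals_at (R : realType) d (S : poMonoidType d) (z : S) :
    set (functional R S) :=
  [set lam | lam z = 1%E].

Definition rank (R : realType) d (S : poMonoidType d) (x : S) :
    functional R S -> \bar R :=
  fun lam => lam x.

Definition rank_ratio (R : realType) d (S : poMonoidType d) (x y : S) :
    \bar R :=
  ereal_inf [set r%:E | r in [set r : R | 0 < r /\
    forall lam : functional R S, (rank x lam <= r%:E * rank y lam)%E]].

Definition has_comparison (R : realType) d (S : poMonoidType d) (w : S)
    (r : R) : Prop :=
  forall x y : S,
    (forall lam : functional R S,
       (rank x lam + r%:E * rank w lam <= rank y lam)%E) ->
    (x <= y)%O.

Definition rc (R : realType) d (S : poMonoidType d) (w : S) : \bar R :=
  ereal_inf [set r%:E | r in [set r : R | 0 < r /\ has_comparison w r]].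

(* The inverse on extended reals satisfies 0^-1 = +oo and +oo^-1 = 0.
   Only the values of [Irc] on [Full S] are meaningful. *)
Definition Irc (R : realType) d (S : poMonoidType d) (x : S) : \bar R :=
  ((rc R x)^-1)%E.

(* Main.v *)
Require Import Defs.
From HB Require Import structures.
From mathcomp Require Import all_boot all_order all_algebra.
From mathcomp Require Import all_classical all_reals all_analysis.

Import Order.TTheory GRing.Theory Num.Theory.
Import numFieldNormedType.Exports.

Local Open Scope classical_set_scope.
Local Open Scope ring_scope.

(* If the rank of x is at most r times the rank of y, then s-comparison relative
   to x gives (r s)-comparison relative to y, whence Irc(x) <= r Irc(y). Parts
   (1) and (2) are instances of this: the rank of n x is n times that of x. In
   (3), the ratio hypothesis provides for each r > 1 an n such that the rank of x
   is at most r times that of x_n; then let r tend to 1. *)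

Lemma functionalMn (R : realType) d (S : poMonoidType d)
    (lam : functional R S) (x : S) (n : nat) :
  lam (x *+ n) = (n%:R%:E * lam x)%E.
Proof.
elim: n => [|n IHn]; first by rewrite mulr0n functional0 mul0e.
rewrite mulrS functionalD IHn -natr1 EFinD addeC.
by rewrite ge0_muleDl ?lee_fin ?ler0n// mul1e.
Qed.

Lemma rc_ge0 (R : realType) d (S : poMonoidType d) (x : S) : (0 <= rc R x)%E.
Proof.
by apply: le_ereal_inf_tmp => _ [r [r0 _] <-]; rewrite lee_fin ltW.
Qed.

Lemma Irc_ge0 (R : realType) d (S : poMonoidType d) (x : S) :
  (0 <= Irc R x)%E.
Proof. by rewrite inve_ge0 rc_ge0. Qed.

(** Multiplying the rank bound by [s] shows that any pair [a], [b] satisfying the inequality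
    required for [y] and [r * s] also satisfies the one for [x] and [s]. *)
Lemma has_comparisonM (R : realType) d (S : poMonoidType d) (x y : S)
    (r s : R) :
    0 < s -> (forall lam : functional R S, lam x <= r%:E * lam y)%E ->
  has_comparison x s -> has_comparison y (r * s).
Proof.
move=> s0 xy xs a b ab; apply: xs => lam; apply: le_trans (ab lam).
rewrite leeD2l// mulrC EFinM -muleA lee_wpmul2l//; first by rewrite lee_fin ltW.
exact: xy.
Qed.

Lemma rc_le_mul (R : realType) d (S : poMonoidType d) (x y : S) (r : R) :
    0 < r -> (forall lam : functional R S, lam x <= r%:E * lam y)%E ->
  (rc R y <= r%:E * rc R x)%E.
Proof.
(* With [r] moved to the left, the right side is a bare infimum, so each admissible [s] can be
   treated separately. *)
move=> r0 xy; rewrite -lee_pdivrMl//; apply: le_ereal_inf_tmp => _ [s [s0 xs] <-].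
rewrite lee_pdivrMl//; apply: ereal_inf_lbound; exists (r * s) => //.
by split; [exact: mulr_gt0|exact: has_comparisonM xs].
Qed.

Lemma Irc_le_mul (R : realType) d (S : poMonoidType d) (x y : S) (r : R) :
    0 < r -> (forall lam : functional R S, lam x <= r%:E * lam y)%E ->
  (Irc R x <= r%:E * Irc R y)%E.
Proof.
move=> r0 xy; rewrite -lee_pdivrMl// /Irc.
have r0' : (r%:E != 0)%E by rewrite eqe gt_eqF.
have rE : ((r^-1)%:E = (r%:E)^-1)%E by rewrite inver gt_eqF.
(* [rc R x] may be 0 or infinite; the inverse still splits over the product because [r] is positive
   and finite. *)
rewrite rE -inveM; last first.
  by rewrite inveM_defE (negbTE r0') /= ltry lte_fin r0 lee_fin ltW// !implybT.
by rewrite lee_pV2 ?rc_le_mul// inE ?rc_ge0// mule_ge0 ?rc_ge0// lee_fin ltW.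
Qed.

Lemma le_Irc (R : realType) d (S : poMonoidType d) (x y : S) :
  (x <= y)%O -> (Irc R x <= Irc R y)%E.
Proof.
move=> xy; rewrite -[leRHS]mul1e; apply: Irc_le_mul => // lam.
by rewrite mul1e functional_le.
Qed.

Lemma IrcMn (R : realType) d (S : poMonoidType d) (x : S) (n : nat) :
  (0 < n)%N -> Irc R (x *+ n) = (n%:R%:E * Irc R x)%E.
Proof.
move=> n0; have n0R : 0 < n%:R :> R by rewrite ltr0n.
apply/eqP; rewrite eq_le; apply/andP; split.
  by apply: Irc_le_mul => // lam; rewrite functionalMn.
(* The converse swaps the roles of [x] and [x *+ n], with ratio [1/n]. *)
rewrite -lee_pdivlMl//; apply: Irc_le_mul => [|lam]; first by rewrite invr_gt0.
by rewrite functionalMn muleA -EFinM mulVf ?gt_eqF// mul1e.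
Qed.

(** Strictness yields an admissible ratio [s < r], and [s] can be raised to [r] because functionals
    are nonnegative. *)
Lemma rank_ratio_lt (R : realType) d (S : poMonoidType d) (x y : S) (r : R) :
    (rank_ratio R x y < r%:E)%E ->
  0 < r /\ forall lam : functional R S, (lam x <= r%:E * lam y)%E.
Proof.
move=> /ereal_inf_lt[_ [s [s0 xy] <-]]; rewrite lte_fin => sr.
split=> [|lam]; first exact: lt_trans sr.
by apply: le_trans (xy lam) _; rewrite lee_wpmul2r ?functional_ge0// lee_fin ltW.
Qed.

Lemma Irc_sup (R : realType) d (S : poMonoidType d) (u : nat -> S) (x : S) :
    supremums (range u) x ->
    rank_ratio R x (u n) @[n --> \oo] --> 1%E ->
  ereal_sup (range (fun n => Irc R (u n))) = Irc R x.
Proof.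
move=> [ux _] ratio1; apply/eqP; rewrite eq_le; apply/andP; split.
  by apply: ge_ereal_sup => _ [n _ <-]; apply/le_Irc/ux; exists n.
(* It suffices to bound [q * Irc R x] for every [q] in [(0, 1)]. Since [1/q > 1], the ratio is
   eventually below [1/q], which serves as the factor [r]. *)
apply/lee_mul01Pr => [|q /andP[q0 q1]]; first exact: Irc_ge0.
have : \forall n \near \oo, (rank_ratio R x (u n) < (q^-1)%:E)%E.
  by apply: (ratio1 [set z | (z < _)%E]); apply: open_ereal_lt'; rewrite lte_fin invf_gt1.
case=> n _ /(_ n (leqnn n)) /rank_ratio_lt[r0 xun].
apply: (@le_trans _ _ (Irc R (u n))); last first.
  by apply: ereal_sup_ubound; exists n.
by rewrite -[q]invrK lee_pdivrMl//; exact: Irc_le_mul.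
Qed.

Theorem proposition5p9 (R : realType) (d : Order.disp_t)
    (S : poMonoidType d)
    (hCu : is_Cu_semigroup S) (hFull : @Full d S !=set0) :
  (forall x y : S, Full x -> Full y -> (x <= y)%O ->
     (Irc R x <= Irc R y)%E) /\
  (forall (x : S) (n : nat), Full x -> (0 < n)%N ->
     Irc R (x *+ n) = (n%:R%:E * Irc R x)%E) /\
  (forall (u : nat -> S) (x : S),
     nondecreasing_seq u -> (forall n, Full (u n)) ->
     supremums (range u) x ->
     (functionals_at x : set (functional R S)) !=set0 ->
     rank_ratio R x (u n) @[n --> \oo] --> 1%E ->
     ereal_sup (range (fun n => Irc R (u n))) = Irc R x).
Proof.
split; [|split].
- by move=> x y _ _; exact: le_Irc.
- by move=> x n _; exact: IrcMn.
- by move=> u x _ _ ux _; exact: Irc_sup.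
Qed.
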